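(* Let $Y$, $x$, $T$ be as in the context, and let $W$ be an irreducible $T$-module with diameter $d\ge1$, endpoint $r$ and dual endpoint $t$. Then $$a^*_0(W)=\frac{\theta^*_{r+1}\theta_t-\theta_{t+1}\theta^*_r}{\theta_t-\theta_{t+1}}.$$
   Context: $Y=(X,\{R_i\}_{0\le i\le D})$ is a symmetric association scheme ($X$ finite; $R_i$ partition $X\times X$, $R_0$ diagonal, $R_i$ symmetric; $p^h_{ij}=|\{z:(x,z)\in R_i,(z,y)\in R_j\}|$ for $(x,y)\in R_h$ independent of $x,y$), with $D\ge3$, associate matrices $A_i$, Bose–Mesner algebra $M=\mathrm{span}\{A_i\}$ with primitive idempotents $E_0,\dots,E_D$, Krein parameters $q^h_{ij}$ ($E_i\circ E_j=|X|^{-1}\sum_hq^h_{ij}E_h$). $Y$ is P-polynomial w.r.t. $R_0,\dots,R_D$ ($p^h_{ij}=0$ if one of $h,i,j$ exceeds the sum of the other two, $\ne0$ if it equals that sum), almost-bipartite ($p^i_{1i}=0$ for $0\le i\le D-1$, $p^D_{1D}\ne0$), and Q-polynomial w.r.t. $E_0,\dots,E_D$ (same conditions for $q^h_{ij}$). $A=A_1$, $AE_i=\theta_iE_i$. Fix $x\in X$: $E^*_i$ diagonal with $(E^*_i)_{yy}=1$ iff $(x,y)\in R_i$; $A^*$ diagonal with $(A^* )_{yy}=|X|(E_1)_{xy}$; $A^*E^*_i=\theta^*_iE^*_i$. $T=T(x)$ is generated by $M$ and $\mathrm{span}\{E^*_i\}$. $F^*=\sum_iE_iA^*E_i$. For an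 irreducible $T$-module $W$: endpoint $r=\min\{i:E^*_iW\neq0\}$, dual endpoint $t=\min\{i:E_iW\ne0\}$, diameter $d=|\{i:E^*_iW\ne0\}|-1$. In this setting $W$ is dual thin, so $E_tW$ is one-dimensional and $F^*$ (which maps $E_tW$ into itself) acts on it as a scalar; $a^*_0(W)$ denotes this scalar, i.e. $F^*E_tv=a^*_0(W)E_tv$ for nonzero $v\in E^*_rW$. *)

(* Defs.v *)
From HB Require Import structures.
From mathcomp Require Import all_boot all_order all_algebra.
From mathcomp Require Import complex.
From mathcomp Require Import reals.

Set Implicit Arguments.
Unset Strict Implicit.
Unset Printing Implicit Defensive.

Import Order.TTheory GRing.Theory Num.Theory.
Local Open Scope ring_scope.

(* [intersection_number Y h i j] is p^h_{ij}: the upper index comes first.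
   [srel_nonempty] makes the R_i genuine blocks of a partition, so that the
   intersection numbers are determined by the relations. *)
Record sym_scheme (X : finType) (D : nat) := SymScheme {
  srel :> 'I_D.+1 -> rel X;
  intersection_number : 'I_D.+1 -> 'I_D.+1 -> 'I_D.+1 -> nat;
  srel_partition : forall x y : X, exists! i, srel i x y;
  srel_nonempty : forall i, exists x y : X, srel i x y;
  srel0 : forall x y : X, srel ord0 x y = (x == y);
  srel_sym : forall i, symmetric (srel i);
  intersection_numberP : forall (h i j : 'I_D.+1) (x y : X), srel h x y ->
    #|[pred z | srel i x z && srel j z y]| = intersection_number h i j
}.

(* The pattern of vanishing shared by the intersection numbers of a
   P-polynomial scheme and the Krein parameters of a Q-polynomial one. *)
Definition polynomial_pattern (V : nmodType) (D : nat)
    (c : 'I_D.+1 -> 'I_D.+1 -> 'I_D.+1 -> V) : Prop :=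
  forall h i j : 'I_D.+1,
    ([|| i + j < h, h + j < i | h + i < j]%N -> c h i j = 0) /\
    ([|| h == i + j :> nat, i == h + j :> nat | j == h + i :> nat]%N ->
       c h i j <> 0).

Definition P_polynomial (X : finType) (D : nat) (Y : sym_scheme X D) : Prop :=
  polynomial_pattern (intersection_number Y).

(* For 1 <= D, [inord 1 : 'I_D.+1] is the index 1. *)
Definition almost_bipartite (X : finType) (D : nat) (Y : sym_scheme X D) :
    Prop :=
  (forall i : 'I_D.+1, (i < D)%N -> intersection_number Y i (inord 1) i = 0%N)
  /\ intersection_number Y ord_max (inord 1) ord_max <> 0%N.

(* Matrices with rows and columns indexed by X are square matrices of size
   #|X|, the index u standing for the point [enum_val u]; they act by left
   multiplication on the column vectors 'cV[K]_#|X|. *)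
Definition associate_mx (K : fieldType) (X : finType) (D : nat)
    (Y : sym_scheme X D) (i : 'I_D.+1) : 'M[K]_#|X| :=
  \matrix_(u, v) (Y i (enum_val u) (enum_val v))%:R.

Definition bose_mesner (K : fieldType) (X : finType) (D : nat)
    (Y : sym_scheme X D) : {vspace 'M[K]_#|X|} :=
  <<[seq associate_mx K Y i | i : 'I_D.+1]>>%VS.

(* E_0, ..., E_D is the basis of the Bose-Mesner algebra consisting of its
   primitive idempotents, numbered so that E_0 = |X|^-1 J. *)
Record primitive_idempotents (K : fieldType) (X : finType) (D : nat)
    (Y : sym_scheme X D) (E : 'I_D.+1 -> 'M[K]_#|X|) : Prop := {
  pidem_basis : basis_of (bose_mesner K Y) [seq E i | i : 'I_D.+1];
  pidem0 : E ord0 = (#|X|%:R)^-1 *: const_mx 1;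
  pidem_sum : \sum_i E i = 1%:M;
  pidem_mul : forall i j, E i *m E j = if i == j then E i else 0
}.

(* [krein E h i j] is q^h_{ij}: |X| times the coefficient of E_h in the
   entrywise product of E_i and E_j. *)
Definition krein (K : fieldType) (X : finType) (D : nat)
    (E : 'I_D.+1 -> 'M[K]_#|X|) (h i j : 'I_D.+1) : K :=
  #|X|%:R * coord [tuple E k | k < D.+1] h (map2_mx *%R (E i) (E j)).

Definition Q_polynomial (K : fieldType) (X : finType) (D : nat)
    (E : 'I_D.+1 -> 'M[K]_#|X|) : Prop :=
  polynomial_pattern (krein E).

Definition dual_idempotent (K : fieldType) (X : finType) (D : nat)
    (Y : sym_scheme X D) (x : X) (i : 'I_D.+1) : 'M[K]_#|X| :=
  diag_mx (\row_u (Y i x (enum_val u))%:R).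

(* A^* = A^*(x), with diagonal entries |X| (E_1)_{xy}. *)
Definition dual_associate_mx (K : fieldType) (X : finType) (D : nat)
    (E : 'I_D.+1 -> 'M[K]_#|X|) (x : X) : 'M[K]_#|X| :=
  diag_mx (\row_u (#|X|%:R * E (inord 1) (enum_rank x) u)).

Definition dual_bose_mesner (K : fieldType) (X : finType) (D : nat)
    (Y : sym_scheme X D) (x : X) : {vspace 'M[K]_#|X|} :=
  <<[seq dual_idempotent K Y x i | i : 'I_D.+1]>>%VS.

Inductive generated_algebra (K : fieldType) (n : nat) (G : 'M[K]_n -> Prop) :
    'M[K]_n -> Prop :=
| gen_incl B : G B -> generated_algebra G B
| gen_one : generated_algebra G 1%:M
| gen_add B C : generated_algebra G B -> generated_algebra G C ->
    generated_algebra G (B + C)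
| gen_scale a B : generated_algebra G B -> generated_algebra G (a *: B)
| gen_mul B C : generated_algebra G B -> generated_algebra G C ->
    generated_algebra G (B *m C).

Definition terwilliger_algebra (K : fieldType) (X : finType) (D : nat)
    (Y : sym_scheme X D) (x : X) : 'M[K]_#|X| -> Prop :=
  generated_algebra
    (fun B => B \in bose_mesner K Y \/ B \in dual_bose_mesner K Y x).

Definition is_module (K : fieldType) (n : nat) (T : 'M[K]_n -> Prop)
    (W : {vspace 'cV[K]_n}) : Prop :=
  forall B w, T B -> w \in W -> B *m w \in W.

Definition irreducible_module (K : fieldType) (n : nat) (T : 'M[K]_n -> Prop)
    (W : {vspace 'cV[K]_n}) : Prop :=
  [/\ is_module T W, W <> 0%VS &
      forall U : {vspace 'cV[K]_n}, is_module T U -> (U <= W)%VS ->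
        U = 0%VS \/ U = W].

(* The subspace B W. *)
Definition mx_image (K : fieldType) (n : nat) (B : 'M[K]_n)
    (W : {vspace 'cV[K]_n}) : {vspace 'cV[K]_n} :=
  (linfun (mulmx B) @: W)%VS.

Definition is_first_support (K : fieldType) (n D : nat)
    (F : 'I_D.+1 -> 'M[K]_n) (W : {vspace 'cV[K]_n}) (r : 'I_D.+1) : Prop :=
  mx_image (F r) W <> 0%VS /\
  forall i : 'I_D.+1, mx_image (F i) W <> 0%VS -> (r <= i)%N.

Definition is_endpoint (K : fieldType) (X : finType) (D : nat)
    (Y : sym_scheme X D) (x : X) (W : {vspace 'cV[K]_#|X|}) (r : 'I_D.+1) :
    Prop :=
  is_first_support (dual_idempotent K Y x) W r.

Definition is_dual_endpoint (K : fieldType) (X : finType) (D : nat)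
    (E : 'I_D.+1 -> 'M[K]_#|X|) (W : {vspace 'cV[K]_#|X|}) (t : 'I_D.+1) :
    Prop :=
  is_first_support E W t.

Definition diameter (K : fieldType) (X : finType) (D : nat)
    (Y : sym_scheme X D) (x : X) (W : {vspace 'cV[K]_#|X|}) : nat :=
  #|[pred i : 'I_D.+1 | mx_image (dual_idempotent K Y x i) W != 0%VS]|.-1.

Definition Fstar (K : fieldType) (X : finType) (D : nat)
    (E : 'I_D.+1 -> 'M[K]_#|X|) (x : X) : 'M[K]_#|X| :=
  \sum_i E i *m dual_associate_mx E x *m E i.

(* [a] is the scalar a^*_0(W) by which F^* acts on E_t W, for t the dual
   endpoint of W; as E_t W <> 0, at most one [a] qualifies. *)
Definition is_a0star (K : fieldType) (X : finType) (D : nat)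
    (E : 'I_D.+1 -> 'M[K]_#|X|) (x : X) (W : {vspace 'cV[K]_#|X|})
    (t : 'I_D.+1) (a : K) : Prop :=
  forall w, w \in mx_image (E t) W -> Fstar E x *m w = a *: w.

(* Main.v *)
(* Let [v] be an eigenvector of [E*_r A^2] in [E*_r W].  Since the scheme is
   almost-bipartite, [A v] lies in [E*_(r+1) W], and [A^2 v] in the sum of
   [C v] and a single [E*_s W].  Hence [E_i A* p(A) v] is a multiple of [E_i v]
   whenever [p] has degree at most 2.  By the Q-polynomial property at most three
   terms [E_i A* E_j v] of this vector are nonzero, and the eigenvalues [theta_j]
   are distinct, so each [E_i A* E_j v] is a multiple of [E_i v].  The span of the
   [E_i v] is then a T-module, so it is [W], and [E_t W] is spanned by [E_t v].
   Comparing [E_t A* v] with [E_t A* A v] gives two linear equations for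
   [E_t A* E_t v] and [E_t A* E_(t+1) v]; solving them gives the scalar. *)
Require Import Defs.
From HB Require Import structures.
From mathcomp Require Import all_boot all_order all_algebra.
From mathcomp Require Import spectral complex zify ring.
From mathcomp Require Import reals.

Set Implicit Arguments.
Unset Strict Implicit.
Unset Printing Implicit Defensive.

Import Order.TTheory GRing.Theory Num.Theory.
Local Open Scope ring_scope.
Local Open Scope complex_scope.

(** * Eigenvectors in stable subspaces, spans of families, and induction along a polynomial
    pattern *)

Lemma stable_eigenvector (C : numClosedFieldType) (vT : vectType C)
    (f : 'End(vT)) (U : {vspace vT}) :
  U <> 0%VS -> (f @: U <= U)%VS ->
  exists v a, [/\ v \in U, v != 0 & f v = a *: v].
Proof.
move=> /eqP U0 fU; pose b := vbasis U; pose k := \dim U.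
(* Row [i] of [G] holds the coordinates of the image of the [i]-th basis vector, so it is a row
   eigenvector of [G] that yields an eigenvector of [f]. *)
pose G : 'M[C]_k := \matrix_(i, j) coord b j (f b`_i).
have k0 : (0 < k)%N by rewrite lt0n dimv_eq0.
have [a /eigenvalueP[g gG g0]] := eigenvalue_closed G k0.
have bU (i : 'I_k) : b`_i \in U by apply: vbasis_mem; rewrite mem_nth ?size_tuple.
exists (\sum_i g 0 i *: b`_i), a; split.
- by apply: memv_suml => i _; apply: memvZ.
- apply: contra_neq g0 => g0; apply/rowP => i; rewrite mxE.
  by have /freeP/(_ (g 0) g0 i) := basis_free (vbasisP U).
- have fb (i : 'I_k) : f b`_i = \sum_j G i j *: b`_j.
    rewrite [LHS](coord_vbasis (subvP fU _ (memv_img f (bU i)))).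
    by apply: eq_bigr => j _; rewrite mxE.
  rewrite linear_sum /=; under eq_bigr do rewrite linearZ /= fb scaler_sumr.
  rewrite exchange_big scaler_sumr; apply: eq_bigr => j _ /=.
  under eq_bigr do rewrite scalerA.
  by rewrite -scaler_suml scalerA; congr (_ *: _); move/rowP/(_ j): gG; rewrite !mxE.
Qed.

Lemma memv_span_image (K : fieldType) (vT : vectType K) (I : finType)
    (F : I -> vT) (v : vT) :
  v \in <<[seq F i | i : I]>>%VS -> exists c : I -> K, v = \sum_i c i *: F i.
Proof.
rewrite span_def big_image /= => /memv_sumP[u uF ->].
have /fin_all_exists[c Hc] i : exists c, u i = c *: F i by exact/vlineP/uF.
by exists c; apply: eq_bigr.
Qed.

(** By the pattern, the product of B_1 and B_k involves no B_h with h > k + 1 and involves B_{k+1}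
    with a nonzero coefficient. Solving for B_{k+1} makes each B_k a polynomial in B_1. This serves
    both the associate and the dual associate matrices. *)
Lemma polynomial_pattern_ind (K : fieldType) (D n : nat)
    (c : 'I_D.+1 -> 'I_D.+1 -> 'I_D.+1 -> K) (B : 'I_D.+1 -> 'M[K]_n)
    (P : 'M[K]_n -> Prop) :
  (0 < D)%N -> polynomial_pattern c ->
  (forall k, B (inord 1) *m B k = \sum_h c h (inord 1) k *: B h) ->
  P (B ord0) -> (forall M N, P M -> P N -> P (M + N)) ->
  (forall a M, P M -> P (a *: M)) ->
  (forall M, P M -> P (B (inord 1) *m M)) ->
  forall k, P (B k).
Proof.
move=> D0 cP BB P0 PD PZ PB.
have v1 : (inord 1 : 'I_D.+1) = 1%N :> nat by rewrite inordK.
suff H m : forall k : 'I_D.+1, (k <= m)%N -> P (B k) by move=> k; apply: H (leqnn _).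
elim: m => [|m IH] k km.
  by have -> : k = ord0 by apply/val_inj/eqP; rewrite -leqn0.
have [/IH//|{}km] : (k <= m)%N \/ k = m.+1 :> nat.
  by move: km; rewrite leq_eqVlt => /orP[/eqP|]; [right|left].
have mD : (m < D.+1)%N by rewrite -ltnS -km ltnS ltnW // ltn_ord.
pose j := Ordinal mD.
have c0 : c k (inord 1) j != 0.
  by apply/eqP; apply (cP k (inord 1) j).2; rewrite v1 km add1n eqxx.
have -> : B k = (c k (inord 1) j)^-1 *:
    (B (inord 1) *m B j + (-1) *: \sum_(h < D.+1 | (h <= m)%N) c h (inord 1) j *: B h).
  rewrite BB (bigID (fun h : 'I_D.+1 => (h <= m)%N)) /= scaleN1r addrAC subrr add0r.
  rewrite (bigD1 k) /=; last by rewrite km -ltnNge.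
  rewrite big1 ?addr0 ?scalerA ?mulVf ?scale1r // => h /andP[hm hk].
  rewrite (cP h (inord 1) j).1 ?scale0r // v1 add1n /= ltn_neqAle -km.
  by rewrite [_ == _]eq_sym (inj_eq val_inj) hk km ltnNge hm.
apply: (PZ); apply: (PD); first exact/PB/IH.
apply: (PZ); elim/big_ind: _ => [|M N PM PN|h hm]; last exact/PZ/IH.
  (* The empty sum calls for [P 0], obtained from a zero multiple of [B ord0]. *)
  by rewrite -(scale0r (B ord0)); exact: (PZ).
exact: PD.
Qed.

(** This supplies the two roots of the quadratic that isolates [j] among the indices at distance at
    most 1 from [i]. The chosen witnesses coincide when [i] is 0 or [D]. *)
Lemma three_neighbours (D : nat) (i j : 'I_D.+1) :
  (1 < D)%N -> (i <= j.+1)%N -> (j <= i.+1)%N ->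
  exists k1 k2 : 'I_D.+1, [/\ k1 != j, k2 != j &
    forall m : 'I_D.+1, (i <= m.+1)%N -> (m <= i.+1)%N -> [|| m == j, m == k1 | m == k2]].
Proof.
move=> D1 ij ji; have iD := ltn_ord i; have jD := ltn_ord j.
suff [k1 [k2 [H1 H2 H3]]] : exists k1 k2 : nat,
    [/\ (k1 < D.+1) && (k1 != j), (k2 < D.+1) && (k2 != j) &
      forall m, (m < D.+1)%N -> (i <= m.+1)%N -> (m <= i.+1)%N ->
        [|| m == j, m == k1 | m == k2]]%N.
  case/andP: H1 => k1D H1; case/andP: H2 => k2D H2.
  by exists (Ordinal k1D), (Ordinal k2D); split=> // m; apply: H3.
have [->|ni] := eqVneq (i : nat) j.
  have [j0|j0] := posnP j.
    by exists 1%N, 1%N; rewrite j0 /=; split; lia.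
  have [jm|jm] := eqVneq (j : nat) D.
    by exists j.-1, j.-1; split; lia.
  by exists j.-1, j.+1; split; lia.
have [ij'|ij'] := ltnP i j.
  have [i0|i0] := posnP i.
    by exists i, i; split; lia.
  by exists i, i.-1; split; lia.
have [jm|jm] := eqVneq (i : nat) D.
  by exists i, i; split; lia.
by exists i, i.+1; split; lia.
Qed.

(** * The Bose-Mesner algebra: products, transposes, conjugates and entrywise products *)

Section Scheme.
Variables (C : numClosedFieldType) (X : finType) (D : nat) (Y : sym_scheme X D).

Local Notation n := #|X|.
Local Notation A := (associate_mx C Y).
Local Notation M := (bose_mesner C Y).
Local Notation one := (inord 1 : 'I_D.+1).

Lemma srel_fun (i j : 'I_D.+1) (x y : X) : Y i x y -> Y j x y -> i = j.
Proof.
by move=> ixy jxy; have [h [_ u]] := srel_partition Y x y; rewrite -(u _ ixy) (u _ jxy).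
Qed.

Lemma srelC (i : 'I_D.+1) (x y : X) : Y i x y = Y i y x.
Proof. exact: srel_sym. Qed.

Lemma intersection_number_neq0 (h i j : 'I_D.+1) (x y z : X) :
  Y h x y -> Y i x z -> Y j z y -> intersection_number Y h i j != 0%N.
Proof.
move=> hxy ixz jzy; rewrite -(intersection_numberP i j hxy) -lt0n.
by apply/card_gt0P; exists z; rewrite inE ixz.
Qed.

Lemma associate_mx_entry (h i : 'I_D.+1) (u v : 'I_n) :
  Y h (enum_val u) (enum_val v) -> A i u v = (i == h)%:R.
Proof.
move=> hP; rewrite mxE; case: eqP => [->|ih]; first by rewrite hP.
by case: (boolP (Y i _ _)) => // /(srel_fun hP)/esym.
Qed.

Lemma sum_associate_mx_entry (c : 'I_D.+1 -> C) (h : 'I_D.+1) (u v : 'I_n) :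
  Y h (enum_val u) (enum_val v) -> (\sum_i c i *: A i) u v = c h.
Proof.
move=> hP; rewrite summxE (bigD1 h) //= mxE (associate_mx_entry _ hP) eqxx mulr1.
rewrite big1 ?addr0 // => i ih.
by rewrite mxE (associate_mx_entry _ hP) (negPf ih) mulr0.
Qed.

Lemma mul_associate_mx (i j : 'I_D.+1) :
  A i *m A j = \sum_h (intersection_number Y h i j)%:R *: A h.
Proof.
apply/matrixP => u v.
have [h [hP _]] := srel_partition Y (enum_val u) (enum_val v).
rewrite (sum_associate_mx_entry _ hP) mxE.
rewrite -(intersection_numberP i j hP).
rewrite -[X in _ = X%:R]sum1_card natr_sum [RHS](reindex _ (onW_bij _ (@enum_val_bij X))) /=.
rewrite [RHS]big_mkcond; apply: eq_bigr => w _; rewrite !mxE inE.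
by case: (Y i _ _); case: (Y j _ _); rewrite ?mulr1 ?mulr0.
Qed.

Lemma associate_mx0 : A ord0 = 1%:M.
Proof. by apply/matrixP => u v; rewrite !mxE srel0 (inj_eq enum_val_inj). Qed.

Lemma associate_mx_bose_mesner (i : 'I_D.+1) : A i \in M.
Proof. by apply: memv_span; apply: map_f; rewrite mem_enum. Qed.

Lemma bose_mesner_tr (B : 'M[C]_n) : B \in M -> B^T = B.
Proof.
move=> /memv_span_image[c ->]; rewrite linear_sum; apply: eq_bigr => i _ /=.
by rewrite linearZ /=; congr (_ *: _); apply/matrixP => u v; rewrite !mxE srelC.
Qed.

Lemma bose_mesner_conj (B : 'M[C]_n) : B \in M -> map_mx Num.conj B \in M.
Proof.
move=> /memv_span_image[c ->]; rewrite map_mx_sum; apply: memv_suml => i _.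
rewrite map_mxZ; apply: memvZ; have -> : map_mx Num.conj (A i) = A i.
  by apply/matrixP => u v; rewrite !mxE rmorph_nat.
exact: associate_mx_bose_mesner.
Qed.

Lemma bose_mesner_hadamard (B1 B2 : 'M[C]_n) :
  B1 \in M -> B2 \in M -> map2_mx *%R B1 B2 \in M.
Proof.
move=> /memv_span_image[b ->] /memv_span_image[c ->].
have -> : map2_mx *%R (\sum_i b i *: A i) (\sum_i c i *: A i)
    = \sum_i (b i * c i) *: A i.
  apply/matrixP => u v.
  have [h [hP _]] := srel_partition Y (enum_val u) (enum_val v).
  by rewrite [LHS]mxE !(sum_associate_mx_entry _ hP).
apply: memv_suml => i _; exact/memvZ/associate_mx_bose_mesner.
Qed.

(** * Primitive idempotents: expansions, reality and Krein parameters *)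

Variable E : 'I_D.+1 -> 'M[C]_#|X|.
Hypothesis hE : primitive_idempotents Y E.

Lemma bose_mesner_idempotents (B : 'M[C]_n) :
  B \in M -> exists b : 'I_D.+1 -> C, B = \sum_k b k *: E k.
Proof. by rewrite -(span_basis (pidem_basis hE)); apply: memv_span_image. Qed.

Lemma pidem_bose_mesner (i : 'I_D.+1) : E i \in M.
Proof.
rewrite -(span_basis (pidem_basis hE)); apply: memv_span.
by apply: map_f; rewrite mem_enum.
Qed.

Lemma pidem_neq0 (i : 'I_D.+1) : E i != 0.
Proof.
have /basis_free/free_not0 := pidem_basis hE; apply.
by apply: map_f; rewrite mem_enum.
Qed.

Lemma pidem_tr (i : 'I_D.+1) : (E i)^T = E i.
Proof. exact/bose_mesner_tr/pidem_bose_mesner. Qed.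

Lemma pidem_id (i : 'I_D.+1) : E i *m E i = E i.
Proof. by rewrite (pidem_mul hE) eqxx. Qed.

Lemma pidem_mul0 (i j : 'I_D.+1) : i != j -> E i *m E j = 0.
Proof. by move=> ij; rewrite (pidem_mul hE) (negPf ij). Qed.

Lemma mul_pidem_sum (m : nat) (c : 'I_D.+1 -> C) (B : 'M[C]_(n, m)) (k : 'I_D.+1) :
  E k *m (\sum_i c i *: E i *m B) = c k *: (E k *m B).
Proof.
rewrite mulmx_sumr (bigD1 k) //= -scalemxAl -scalemxAr mulmxA pidem_id.
rewrite big1 ?addr0 // => i ik; rewrite -scalemxAl -scalemxAr mulmxA.
by rewrite pidem_mul0 1?eq_sym // mul0mx scaler0.
Qed.

Lemma mul_sum_pidem (c : 'I_D.+1 -> C) (k : 'I_D.+1) :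
  (\sum_i c i *: E i) *m E k = c k *: E k.
Proof.
rewrite mulmx_suml (bigD1 k) //= -scalemxAl pidem_id big1 ?addr0 // => i ik.
by rewrite -scalemxAl pidem_mul0 // scaler0.
Qed.

Lemma bose_mesner_pidem (B : 'M[C]_n) (k : 'I_D.+1) :
  B \in M -> exists b, B *m E k = b *: E k.
Proof.
by move=> /bose_mesner_idempotents[b ->]; exists (b k); apply: mul_sum_pidem.
Qed.

(** The trace is the sum of the squared moduli of the entries of [B]. *)
Lemma adjoint_mul_eq0 (m p : nat) (B : 'M[C]_(m, p)) :
  \tr ((map_mx Num.conj B)^T *m B) = 0 -> B = 0.
Proof.
move=> tr0; apply/matrixP => i j; rewrite mxE; apply/eqP.
rewrite -normr_eq0 -sqrf_eq0.
have nn (k : 'I_p) : 0 <= ((map_mx Num.conj B)^T *m B) k k.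
  by rewrite mxE; apply: sumr_ge0 => l _; rewrite !mxE mulrC mul_conjC_ge0.
have /psumr_eq0P/(_ tr0 j isT) : forall k, true -> 0 <= ((map_mx Num.conj B)^T *m B) k k.
  by move=> k _; apply: nn.
rewrite mxE => /psumr_eq0P; move/(_ _ i isT); rewrite !mxE mulrC -normCK => -> // k _.
by rewrite !mxE mulrC mul_conjC_ge0.
Qed.

(** The conjugates [F k] are again orthogonal idempotents of the algebra. Positivity of the
    Frobenius norm gives [F k *m E k != 0], so for k other than i the relation [F k *m F i = 0]
    kills the E_k-component of [F i]. Hence [F i] is a nonzero multiple of [E i], and idempotence
    makes them equal. *)
Lemma pidem_conj (i : 'I_D.+1) : map_mx Num.conj (E i) = E i.
Proof.
pose F k := map_mx Num.conj (E k).
have FM k : F k \in M by apply/bose_mesner_conj/pidem_bose_mesner.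
have FE0 k : F k *m E k != 0.
  apply: contra_neq (pidem_neq0 k) => FE; apply: adjoint_mul_eq0.
  by rewrite -/(F k) (bose_mesner_tr (FM k)) FE mxtrace0.
have [c Fc] := bose_mesner_idempotents (FM i).
have ck k : k != i -> c k = 0.
  move=> ki; have [d FEd] := bose_mesner_pidem k (FM k).
  have : F k *m F i *m E k = 0 by rewrite -map_mxM pidem_mul0 // map_mx0 mul0mx.
  rewrite -mulmxA Fc mul_sum_pidem -scalemxAr => /eqP.
  by rewrite scaler_eq0 (negPf (FE0 k)) orbF => /eqP.
have Fi : F i = c i *: E i.
  by rewrite Fc (bigD1 i) //= big1 ?addr0 // => k /ck->; rewrite scale0r.
have : F i *m F i = F i by rewrite -map_mxM pidem_id.
have : c i != 0 by apply: contra_neq (FE0 i) => c0; rewrite Fi c0 scale0r mul0mx.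
rewrite -/(F i) {1 2}Fi -scalemxAl -scalemxAr pidem_id => c0.
by rewrite -Fi {2}Fi => /(scalerI c0).
Qed.

Lemma pidem_hadamard (i j : 'I_D.+1) :
  map2_mx *%R (E i) (E j) = \sum_h (#|X|%:R^-1 * krein E h i j) *: E h.
Proof.
(* For empty [X] the factor |X| is not invertible, but then the matrices have no entries. *)
have [X0|X0] := posnP #|X|; first by apply/matrixP => u; have := ltn_ord u; rewrite {2}X0.
have ET : <<[tuple E k | k < D.+1]>>%VS = M.
  by rewrite -(span_basis (pidem_basis hE)).
have := bose_mesner_hadamard (pidem_bose_mesner i) (pidem_bose_mesner j).
rewrite -ET => /coord_span{1}->; apply: eq_bigr => h _.
rewrite /krein mulrA mulVf ?mul1r ?pnatr_eq0 -?lt0n //.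
by rewrite -tnth_nth tnth_mktuple.
Qed.

(** * The dual algebra at the base point, triple products, and a criterion for T-modules *)

Variable x : X.

(** The whole family is needed, beyond the case k = 1 that is [dual_associate_mx]: the dual
    idempotents are combinations of its members, which the Q-polynomial property turns into
    polynomials in [As]. *)
Definition dual_associate (k : 'I_D.+1) : 'M[C]_n :=
  diag_mx (\row_u (#|X|%:R * E k (enum_rank x) u)).

Local Notation As := (dual_associate_mx E x).
Local Notation Es := (dual_idempotent C Y x).

Lemma cardX_neq0 : #|X|%:R != 0 :> C.
Proof. by rewrite pnatr_eq0 -lt0n; apply/card_gt0P; exists x. Qed.

Lemma dual_associate0 : dual_associate ord0 = 1%:M.
Proof.
rewrite /dual_associate (pidem0 hE) -diag_const_mx; congr diag_mx.
by apply/rowP => u; rewrite !mxE mulr1 mulfV // cardX_neq0.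
Qed.

(** Placing row [x] on the diagonal turns the entrywise product of E_1 and E_k into a product of
    diagonal matrices, so the Krein parameters become structure constants. *)
Lemma mul_dual_associate (k : 'I_D.+1) :
  As *m dual_associate k = \sum_h krein E h one k *: dual_associate h.
Proof.
apply/matrixP => u v; rewrite mul_diag_mx summxE !mxE.
under eq_bigr do rewrite !mxE -mulrnAr mulrA.
have := congr1 (fun B : 'M_n => B (enum_rank x) u) (pidem_hadamard one k).
rewrite mxE summxE => EE.
rewrite mulrnAr mulrACA EE -mulrnAl; case: eqP => _; last first.
  by rewrite mulr0n mul0r big1 // => h _; rewrite mulr0n mulr0.
rewrite mulr1n mulr_sumr; apply: eq_bigr => h _; rewrite !mxE mulr1n.
by field; exact: cardX_neq0.
Qed.

(** Expand A_i in the primitive idempotents and place row [x] on the diagonal. *)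
Lemma dual_idempotent_associate (i : 'I_D.+1) :
  exists c : 'I_D.+1 -> C, Es i = \sum_k c k *: dual_associate k.
Proof.
have [c Ac] := bose_mesner_idempotents (associate_mx_bose_mesner i).
exists (fun k => #|X|%:R^-1 * c k); apply/matrixP => u v.
have := congr1 (fun B : 'M_n => B (enum_rank x) u) Ac.
rewrite !mxE enum_rankK summxE => ->; rewrite summxE -sumrMnl; apply: eq_bigr => k _.
rewrite !mxE -mulrnAr mulrnAr -mulrnAr.
case: eqP => _; rewrite ?mulr0n ?mulr0 // !mulr1n.
by field; exact: cardX_neq0.
Qed.

Lemma dual_associate_conj : map_mx Num.conj As = As.
Proof.
apply/matrixP => u v; rewrite !mxE rmorphMn rmorphM rmorph_nat; congr (_ * _ *+ _).
by have := congr1 (fun B : 'M_n => B (enum_rank x) u) (pidem_conj one); rewrite mxE.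
Qed.

(* The squared Frobenius norm of [E_i A^* E_j] is [|X| q^1_{ij} (E_1)_{xx}]. *)
Lemma krein_triple_product (i j : 'I_D.+1) :
  krein E one i j = 0 -> E i *m As *m E j = 0.
Proof.
move=> q0; apply: adjoint_mul_eq0.
rewrite !map_mxM dual_associate_conj !pidem_conj !trmx_mul !pidem_tr tr_diag_mx.
rewrite -!mulmxA (mulmxA (E i) (E i)) pidem_id mxtrace_mulC -!mulmxA pidem_id.
(* The remaining trace, that of [As *m E i *m As *m E j], is |X|^2 times the entry at (x,x) of
   [E one *m H *m E one]. This sandwich keeps only the E_1-component of [H], whose coefficient is
   q^1_{ij} / |X|. *)
pose H := map2_mx *%R (E i) (E j).
have H0 : (E one *m H *m E one) = 0.
  rewrite /H pidem_hadamard mulmx_sumr mulmx_suml big1 // => h _.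
  have [->|h1] := eqVneq h one; first by rewrite q0 mulr0 scale0r mulmx0 mul0mx.
  by rewrite -scalemxAr -scalemxAl pidem_mul0 1?eq_sym // mul0mx scaler0.
pose xr := enum_rank x.
have tE k a b : E k a b = E k b a by rewrite -[in LHS](pidem_tr k) mxE.
have -> : \tr (As *m (E i *m (As *m E j)))
    = #|X|%:R * (#|X|%:R * (E one *m H *m E one) xr xr).
  rewrite [in RHS]mxE !mulr_sumr.
  apply: eq_bigr => u _; rewrite mul_diag_mx !mxE mulr_suml !mulr_sumr.
  apply: eq_bigr => v _; rewrite mul_diag_mx !mxE.
  by rewrite (tE i u v) (tE one u xr); ring.
by rewrite H0 mxE !mulr0.
Qed.

(** If two eigenvalues agreed, every polynomial in A, hence every element of the Bose-Mesner
    algebra, would act by one scalar on both [E i] and [E j]. But [E i] itself acts as 1 on the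
    first and as 0 on the second. *)
Lemma eigenvalue_inj (theta : 'I_D.+1 -> C) :
  (0 < D)%N -> P_polynomial Y -> (forall i, A one *m E i = theta i *: E i) ->
  injective theta.
Proof.
move=> D0 hP hth i j thij; apply/eqP/negPn/negP => ij.
pose P (B : 'M[C]_n) := exists c, B *m E i = c *: E i /\ B *m E j = c *: E j.
have PD B1 B2 : P B1 -> P B2 -> P (B1 + B2).
  by move=> [b [bi bj]] [c [ci cj]]; exists (b + c); rewrite !mulmxDl bi bj ci cj !scalerDl.
have PZ b B : P B -> P (b *: B).
  by move=> [c [ci cj]]; exists (b * c); rewrite -!scalemxAl ci cj !scalerA.
have P1 : P 1%:M by exists 1; rewrite !mul1mx !scale1r.
have PA k : P (A k).
  apply: (@polynomial_pattern_ind _ _ _ (fun h i j => (intersection_number Y h i j)%:R)) => //.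
  - move=> h k1 k2; have [p0 p1] := hP h k1 k2; split=> [/p0->//|/p1/eqP].
    by rewrite -(pnatr_eq0 C) => /eqP.
  - exact: mul_associate_mx.
  - by rewrite associate_mx0.
  - move=> B [c [ci cj]]; exists (c * theta i); rewrite -!mulmxA ci cj -!scalemxAr.
    by rewrite !hth thij !scalerA.
have /memv_span_image[c Ec] := pidem_bose_mesner i.
have [b []] : P (E i).
  rewrite Ec; elim/big_ind: _ => [|//|k _]; last exact: PZ.
  by rewrite -(scale0r 1%:M); apply: PZ.
rewrite pidem_id pidem_mul0 // -{1}(scale1r (E i)) => /eqP.
rewrite -subr_eq0 -scalerBl scaler_eq0 (negPf (pidem_neq0 i)) orbF subr_eq0 => /eqP <-.
by rewrite scale1r => /esym/eqP; apply/negP/pidem_neq0.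
Qed.

(** A nonzero entry at (u,v) would make v a point counted by p^i_{1j} for the pair formed by u and
    [x]. *)
Lemma dual_triple_product (i j : 'I_D.+1) :
  intersection_number Y i one j = 0%N -> Es i *m A one *m Es j = 0.
Proof.
move=> p0; apply/matrixP => u v; rewrite mul_mx_diag mxE mul_diag_mx !mxE.
case: (boolP (Y i _ _)) => [ixu|]; last by rewrite !mul0r.
case: (boolP (Y one _ _)) => [uv|]; last by rewrite mulr0 mul0r.
case: (boolP (Y j _ _)) => [jxv|]; last by rewrite mulr0.
have := @intersection_number_neq0 i one j (enum_val u) x (enum_val v).
by rewrite srelC ixu (srelC _ _ x) jxv uv p0 => /(_ isT isT isT).
Qed.

Lemma sum_dual_idempotent : \sum_i Es i = 1%:M.
Proof.
apply/matrixP => u v; rewrite summxE !mxE.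
have [h [hP _]] := srel_partition Y x (enum_val u).
rewrite (bigD1 h) //= !mxE hP big1 ?addr0 // => i ih.
rewrite !mxE; case: (boolP (Y i _ _)) => [/(srel_fun hP) hi|_]; last by rewrite mul0rn.
by rewrite hi eqxx in ih.
Qed.

Lemma mul_dual_idempotent (i j : 'I_D.+1) :
  Es i *m Es j = if i == j then Es i else 0.
Proof.
apply/matrixP => u v; rewrite mul_diag_mx !mxE.
have [<-|ij] := eqVneq i j; rewrite !mxE.
  by case: (Y i _ _); rewrite ?mul1r ?mul0r ?mul0rn.
case: (boolP (Y i _ _)) => [ixu|_]; last by rewrite mul0r.
case: (boolP (Y j _ _)) => [/(srel_fun ixu) hi|_]; last by rewrite mul0rn mulr0.
by rewrite hi eqxx in ij.
Qed.

Lemma dual_idempotent_sum (w : 'cV[C]_n) (k : 'I_D.+1) :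
  (forall i, i != k -> Es i *m w = 0) -> w = Es k *m w.
Proof.
move=> w0; rewrite -[LHS]mul1mx -sum_dual_idempotent mulmx_suml (bigD1 k) //=.
by rewrite big1 ?addr0.
Qed.

Lemma pidem_mul_commute (theta : 'I_D.+1 -> C) (i : 'I_D.+1) :
  A one *m E i = theta i *: E i -> E i *m A one = theta i *: E i.
Proof.
move=> /(congr1 trmx); rewrite trmx_mul linearZ /= pidem_tr.
by rewrite (bose_mesner_tr (associate_mx_bose_mesner _)).
Qed.

(** Each [Es i] is a combination of dual associate matrices, and these are polynomials in [As]. *)
Lemma dual_associate_stable (U : {vspace 'cV[C]_n}) :
  (0 < D)%N -> Q_polynomial E ->
  (forall u, u \in U -> As *m u \in U) ->
  forall i u, u \in U -> Es i *m u \in U.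
Proof.
move=> D0 hQ AU i u uU; have [c ->] := dual_idempotent_associate i.
rewrite mulmx_suml; apply: memv_suml => k _; rewrite -scalemxAl; apply: memvZ.
move: u uU; apply: (@polynomial_pattern_ind _ _ _ (krein E) dual_associate
  (fun N => forall u, u \in U -> N *m u \in U)) => //.
- exact: mul_dual_associate.
- by move=> u; rewrite dual_associate0 mul1mx.
- by move=> N N' NU NU' u uU; rewrite mulmxDl memvD ?NU ?NU'.
- by move=> b N NU u uU; rewrite -scalemxAl memvZ ?NU.
- by move=> N NU u uU; rewrite -mulmxA AU ?NU.
Qed.

(** The idempotents span the Bose-Mesner algebra and [As] generates the dual one, so stability under
    these suffices. This is the test applied to the span of the E_i v. *)
Lemma terwilliger_module (U : {vspace 'cV[C]_n}) :
  (0 < D)%N -> Q_polynomial E ->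
  (forall i u, u \in U -> E i *m u \in U) ->
  (forall u, u \in U -> As *m u \in U) ->
  is_module (terwilliger_algebra Y x) U.
Proof.
move=> D0 hQ EU AU B u TB; elim: TB u => {B}
  [B|u|B1 B2 _ I1 _ I2 u uU|b B _ I u uU|B1 B2 _ I1 _ I2 u uU].
- case=> [/bose_mesner_idempotents|/memv_span_image] [c ->] u uU; rewrite mulmx_suml;
    apply: memv_suml => k _; rewrite -scalemxAl; apply: memvZ; first exact: EU.
  exact: dual_associate_stable.
- by rewrite mul1mx.
- by rewrite mulmxDl memvD ?I1 ?I2.
- by rewrite -scalemxAl memvZ ?I.
- by rewrite -mulmxA I1 ?I2.
Qed.

End Scheme.

(** * Images of a subspace under a matrix *)

Lemma mem_mx_image (K : fieldType) (n : nat) (B : 'M[K]_n) (W : {vspace 'cV[K]_n})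
    (w : 'cV[K]_n) :
  w \in mx_image B W <-> exists2 u, u \in W & w = B *m u.
Proof.
by split=> [/memv_imgP[u uW ->]|[u uW ->]]; [exists u|apply/memv_imgP; exists u];
  rewrite ?lfunE.
Qed.

Lemma mx_image_neq0 (K : fieldType) (n : nat) (B : 'M[K]_n) (W : {vspace 'cV[K]_n}) :
  mx_image B W <> 0%VS <-> exists2 u, u \in W & B *m u != 0.
Proof.
split=> [/eqP|[u uW Bu0] W0].
  rewrite -vpick0 => p0; have /mem_mx_image[u uW E] := memv_pick (mx_image B W).
  by exists u; rewrite // -E.
case/eqP: Bu0; apply/eqP; rewrite -memv0 -W0; apply/mem_mx_image; exists u => //.
Qed.

(** * The irreducible module and its endpoint eigenvector *)

Section Module.
Variables (C : numClosedFieldType) (X : finType) (D : nat) (Y : sym_scheme X D).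
Variables (E : 'I_D.+1 -> 'M[C]_#|X|) (x : X) (theta thetastar : 'I_D.+1 -> C).
Hypotheses (hD : (1 < D)%N) (hP : P_polynomial Y) (hAB : almost_bipartite Y).
Hypotheses (hE : primitive_idempotents Y E) (hQ : Q_polynomial E).

Local Notation n := #|X|.
Local Notation one := (inord 1 : 'I_D.+1).
Local Notation A := (associate_mx C Y one).
Local Notation As := (dual_associate_mx E x).
Local Notation Es := (dual_idempotent C Y x).
Local Notation T := (@terwilliger_algebra C X D Y x).

Hypothesis htheta : forall i, A *m E i = theta i *: E i.
Hypothesis hthetastar : forall i, As *m Es i = thetastar i *: Es i.

Let D0 : (0 < D)%N. Proof. exact: ltnW. Qed.
Let one1 : (one : nat) = 1%N. Proof. by rewrite inordK. Qed.

Lemma dual_triple_product_far (i j : 'I_D.+1) :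
  ((i.+1 < j) || (j.+1 < i))%N -> Es i *m A *m Es j = 0.
Proof.
by move=> ij; apply: dual_triple_product; apply (hP i one j).1; rewrite one1; lia.
Qed.

Lemma dual_triple_product_diag (i : 'I_D.+1) :
  (i < D)%N -> Es i *m A *m Es i = 0.
Proof. by move=> iD; apply: dual_triple_product; apply: hAB.1. Qed.

Lemma krein_triple_product_far (i j : 'I_D.+1) :
  ((i.+1 < j) || (j.+1 < i))%N -> E i *m As *m E j = 0.
Proof.
by move=> ij; apply: (krein_triple_product hE); apply (hQ one i j).1; rewrite one1; lia.
Qed.

Variable W : {vspace 'cV[C]_n}.
Hypothesis hW : irreducible_module T W.
Variables r t : 'I_D.+1.
Hypotheses (hr : is_endpoint Y x W r) (ht : is_dual_endpoint E W t).

Let WT (B : 'M[C]_n) w : T B -> w \in W -> B *m w \in W.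
Proof. by case: hW => H _ _; apply: H. Qed.

Let TA : T A. Proof. by apply: gen_incl; left; apply: associate_mx_bose_mesner. Qed.
Let TE i : T (E i). Proof. by apply: gen_incl; left; apply: (pidem_bose_mesner hE). Qed.
Let TEs i : T (Es i).
Proof. by apply: gen_incl; right; apply: memv_span; apply: map_f; rewrite mem_enum. Qed.

Let Wlow (i : 'I_D.+1) w : (i < r)%N -> w \in W -> Es i *m w = 0.
Proof.
move=> ir wW; apply/eqP/negPn/negP => w0.
have /hr.2 : mx_image (Es i) W <> 0%VS by apply/mx_image_neq0; exists w.
by rewrite leqNgt ir.
Qed.

Lemma endpoint_eigenvector :
  exists v lam, [/\ v \in W, v != 0, Es r *m v = v & Es r *m (A *m (A *m v)) = lam *: v].
Proof.
pose f : 'End('cV[C]_n) := linfun (mulmx (Es r *m A *m A)).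
have [|v [lam [/mem_mx_image[u uW ->] v0 fv]]] := @stable_eigenvector _ _ f _ hr.1.
  apply/subvP => _ /memv_imgP[_ /mem_mx_image[u uW ->] ->].
  rewrite lfunE /= -!mulmxA; apply/mem_mx_image; exists (A *m (A *m (Es r *m u))) => //.
  by do 3!apply: WT => //.
exists (Es r *m u), lam; split=> //; first exact: WT.
  by rewrite mulmxA mul_dual_idempotent eqxx.
by rewrite -fv lfunE /= !mulmxA.
Qed.

(** * The module is spanned by the components E_i v of the endpoint vector *)

Section EndpointVector.
Variables (v : 'cV[C]_n) (lam : C).
Hypotheses (vW : v \in W) (v0 : v != 0) (vr : Es r *m v = v).
Hypothesis rD : (r < D)%N.

Let r1 : 'I_D.+1 := inord r.+1.
Let r1E : r1 = r.+1 :> nat. Proof. by rewrite inordK. Qed.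

Lemma dual_associate_endpoint : As *m v = thetastar r *: v.
Proof. by rewrite -vr mulmxA hthetastar -scalemxAl. Qed.

(** Minimality of [r] removes the components below [r], almost-bipartiteness together with r < D
    removes the one at [r], and the P-polynomial pattern removes those beyond r + 1. *)
Lemma associate_endpoint : A *m v = Es r1 *m (A *m v).
Proof.
apply: dual_idempotent_sum => i ir1.
have [ir|] := ltnP i r; first by apply: Wlow => //; apply: WT.
rewrite leq_eqVlt => /orP[/eqP/val_inj <-|ri].
  by rewrite -vr !mulmxA dual_triple_product_diag ?mul0mx.
rewrite -vr !mulmxA dual_triple_product_far ?mul0mx //.
by move: ir1; rewrite -(inj_eq val_inj) /= r1E; lia.
Qed.

Lemma dual_associate_endpoint1 : As *m (A *m v) = thetastar r1 *: (A *m v).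
Proof. by rewrite associate_endpoint mulmxA hthetastar -scalemxAl. Qed.

Hypothesis vlam : Es r *m (A *m (A *m v)) = lam *: v.

Lemma dual_associate_endpoint2 : exists s : 'I_D.+1,
  As *m (A *m (A *m v)) =
    (lam * thetastar r) *: v + thetastar s *: (A *m (A *m v) - lam *: v).
Proof.
(* If r + 1 < D, the component of A^2 v at r + 1 vanishes and the new one sits at r + 2. If r + 1 =
   D, there is no index r + 2, but p^D_{1D} may leave a component at D. The minimum covers both
   cases. *)
pose s : 'I_D.+1 := inord (minn r.+2 D).
have sE : s = minn r.+2 D :> nat by rewrite inordK //; lia.
have rs : r != s by rewrite -(inj_eq val_inj) /= sE; lia.
have AvW : A *m (A *m v) \in W by do 2!apply: WT => //.
pose w := A *m (A *m v) - lam *: v.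
have ws : w = Es s *m w.
  apply: dual_idempotent_sum => i i_s; rewrite /w mulmxBr -scalemxAr.
  have [->|ir] := eqVneq i r; first by rewrite vlam vr subrr.
  rewrite -{2}vr [Es i *m (Es r *m v)]mulmxA mul_dual_idempotent (negPf ir).
  rewrite mul0mx scaler0 subr0.
  have [{}ir|ri] := ltnP i r; first exact: Wlow.
  rewrite associate_endpoint !mulmxA.
  have [ir1|ir1] := eqVneq i r1.
    rewrite ir1 dual_triple_product_diag ?mul0mx // r1E.
    by move: i_s; rewrite ir1 -(inj_eq val_inj) /= r1E sE; lia.
  rewrite dual_triple_product_far ?mul0mx // r1E.
  by move: i_s ir ir1 ri (ltn_ord i); rewrite -!(inj_eq val_inj) /= r1E sE; lia.
(* Apply [As] to A^2 v = lam v + w, whose two summands lie in the ranges of [Es r] and [Es s]. *)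
exists s; rewrite -/w ws scalemxAl -hthetastar -mulmxA -ws -scalerA.
by rewrite -dual_associate_endpoint scalemxAr -mulmxDr /w addrC subrK.
Qed.

Lemma pidem_associate i (w : 'cV[C]_n) : E i *m (A *m w) = theta i *: (E i *m w).
Proof. by rewrite mulmxA (pidem_mul_commute hE (htheta i)) -scalemxAl. Qed.

Lemma sum_pidem (w : 'cV[C]_n) : w = \sum_i E i *m w.
Proof. by rewrite -mulmx_suml (pidem_sum hE) mul1mx. Qed.

(* For [p] of degree at most 2, [E i *m As *m p(A) *m v] is a multiple of
   [E i *m v]; choosing [p] to vanish at the eigenvalues of the neighbours of [i]
   other than [j] isolates the term [E i *m As *m E j *m v]. *)
Lemma dual_associate_pidem i j :
  exists c, E i *m (As *m (E j *m v)) = c *: (E i *m v).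
Proof.
have [ij|] := boolP ((i.+1 < j) || (j.+1 < i))%N.
  by exists 0; rewrite !mulmxA krein_triple_product_far // mul0mx scale0r.
rewrite negb_or -!leqNgt => /andP[ji ij].
have [k1 [k2 [k1j k2j nb]]] := three_neighbours hD ij ji.
pose a := theta k1; pose b := theta k2.
pose pv := A *m (A *m v) - (a + b) *: (A *m v) + (a * b) *: v.
(* [As] maps v, A v and A^2 v to combinations of these vectors, and after multiplication by [E i]
   each A becomes the scalar [theta i]. *)
have [c pvc] : exists c, E i *m (As *m pv) = c *: (E i *m v).
  have [s As2] := dual_associate_endpoint2.
  rewrite /pv !mulmxDr mulmxN -!scalemxAr As2 dual_associate_endpoint1.
  rewrite dual_associate_endpoint !mulmxDr mulmxN -!scalemxAr mulmxBr -!scalemxAr.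
  rewrite !pidem_associate !scalerA -scalerBl !scalerA -scalerDl -scalerBl -scalerDl.
  by eexists.
have pvE m : E m *m pv = ((theta m - a) * (theta m - b)) *: (E m *m v).
  rewrite /pv mulmxDr mulmxBr -!scalemxAr !pidem_associate !scalerA -scalerBl -scalerDl.
  by congr (_ *: _); ring.
pose p := (theta j - a) * (theta j - b).
have inj := eigenvalue_inj hE D0 hP htheta.
have p0 : p != 0 by rewrite mulf_neq0 // subr_eq0 (inj_eq inj) eq_sym.
exists (p^-1 * c); rewrite -scalerA -pvc [in RHS](sum_pidem pv) !mulmx_sumr.
rewrite (bigD1 j) //= big1 ?addr0.
  by rewrite pvE -/p -!scalemxAr scalerA mulVf // scale1r.
move=> m mj; rewrite pvE -!scalemxAr.
have [im|] := boolP ((i.+1 < m) || (m.+1 < i))%N.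
  by rewrite !mulmxA krein_triple_product_far // mul0mx scaler0.
rewrite negb_or -!leqNgt => /andP[mi im].
by have := nb m im mi; rewrite (negPf mj) /= => /orP[] /eqP->;
  rewrite subrr ?mulr0 ?mul0r scale0r.
Qed.

Lemma endpoint_span w : w \in W -> exists c : 'I_D.+1 -> C, w = \sum_i c i *: (E i *m v).
Proof.
pose U := <<[seq E i *m v | i : 'I_D.+1]>>%VS.
have EU i : E i *m v \in U by apply: memv_span; apply: map_f; rewrite mem_enum.
suff <- : U = W by apply: memv_span_image.
have UT : is_module T U.
  apply: (terwilliger_module hE D0 hQ) => [i u|u] /memv_span_image[c ->].
    under eq_bigr do rewrite scalemxAl.
    by rewrite (mul_pidem_sum hE) memvZ.
  rewrite mulmx_sumr; apply: memv_suml => j _; rewrite -scalemxAr; apply: memvZ.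
  rewrite (sum_pidem (As *m _)); apply: memv_suml => i _.
  by have [b ->] := dual_associate_pidem i j; apply: memvZ.
have UW : (U <= W)%VS.
  by apply/span_subvP => _ /mapP[i _ ->]; apply: WT.
case: hW => _ _ /(_ U UT UW)[U0|//].
case/eqP: v0; apply/eqP; rewrite -memv0 -U0 (sum_pidem v).
by apply: memv_suml.
Qed.

Lemma pidem_endpoint_span i w : w \in W -> exists c, E i *m w = c *: (E i *m v).
Proof.
move=> /endpoint_span[c ->]; exists (c i).
by under eq_bigr do rewrite scalemxAl; rewrite (mul_pidem_sum hE).
Qed.

(** Every vector of the nonzero space E_t W is a multiple of E_t v. *)
Lemma pidem_dual_endpoint_neq0 : E t *m v != 0.
Proof.
have /mx_image_neq0[w wW] := ht.1; apply: contra_neq => v0t.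
by have [c ->] := pidem_endpoint_span t wW; rewrite v0t scaler0.
Qed.

Lemma pidem_below_dual_endpoint (i : 'I_D.+1) : (i < t)%N -> E i *m v = 0.
Proof.
move=> it; apply/eqP/negPn/negP => iv.
have /ht.2 : mx_image (E i) W <> 0%VS by apply/mx_image_neq0; exists v.
by rewrite leqNgt it.
Qed.

(* If [t = D] then [v = E t *m v] spans [W], against the diameter being positive. *)
Lemma dual_endpoint_lt_diameter (i : 'I_D.+1) :
  i != r -> mx_image (Es i) W <> 0%VS -> (t < D)%N.
Proof.
move=> ir /mx_image_neq0[w wW]; apply: contraNltn => Dt.
have vt : v = E t *m v.
  rewrite [LHS]sum_pidem (bigD1 t) //= big1 ?addr0 // => j jt.
  apply: pidem_below_dual_endpoint; move: jt (ltn_ord j).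
  by rewrite -(inj_eq val_inj) /=; lia.
have [c ->] := endpoint_span wW.
rewrite mulmx_sumr big1 // => j _; rewrite -scalemxAr.
have [->|jt] := eqVneq j t; last first.
  by rewrite vt mulmxA (pidem_mul0 hE jt) mul0mx mulmx0 scaler0.
by rewrite -vt -vr mulmxA mul_dual_idempotent (negPf ir) mul0mx scaler0.
Qed.

Let t1 : 'I_D.+1 := inord t.+1.

(** Let b and c be the scalars by which E_t A^* E_t v and E_t A^* E_{t+1} v are multiples of E_t v.
    The vectors v and A v give [thetastar r = b + c] and [thetastar r1 * theta t = theta t * b +
    theta t1 * c]; eliminating c yields b, the scalar of F^*. *)
Lemma Fstar_dual_endpoint : (t < D)%N ->
  Fstar E x *m (E t *m v) =
    ((thetastar r1 * theta t - theta t1 * thetastar r) / (theta t - theta t1))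
      *: (E t *m v).
Proof.
move=> tD; have t1E : t1 = t.+1 :> nat by rewrite inordK.
have tt1 : t != t1 by rewrite -(inj_eq val_inj) /= t1E; lia.
have dt : theta t - theta t1 != 0.
  by rewrite subr_eq0 (inj_eq (eigenvalue_inj hE D0 hP htheta)).
have FE : Fstar E x *m (E t *m v) = E t *m (As *m (E t *m v)).
  rewrite /Fstar mulmx_suml (bigD1 t) //= big1 ?addr0 => [|i it]; last first.
    by rewrite -!mulmxA (mulmxA (E i) (E t)) (pidem_mul0 hE it) mul0mx !mulmx0.
  by rewrite -!mulmxA (mulmxA (E t) (E t)) (pidem_id hE).
(* The hypothesis on [w] kills the terms below [t], and the Q-polynomial property those above t +
   1. *)
have split2 (w : 'cV[C]_n) : (forall i : 'I_D.+1, (i < t)%N -> E i *m w = 0) ->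
    E t *m (As *m w) = E t *m (As *m (E t *m w)) + E t *m (As *m (E t1 *m w)).
  move=> wlow; rewrite {1}(sum_pidem w) !mulmx_sumr (bigD1 t) //= (bigD1 t1) 1?eq_sym //=.
  rewrite big1 ?addr0 // => i /andP[it it1].
  have [/wlow->|ti] := ltnP i t; first by rewrite !mulmx0.
  rewrite !mulmxA krein_triple_product_far ?mul0mx //.
  by move: it it1; rewrite -!(inj_eq val_inj) /= t1E; lia.
have [b Eb] := dual_associate_pidem t t; have [c Ec] := dual_associate_pidem t t1.
have := split2 v pidem_below_dual_endpoint.
have := split2 (A *m v).
rewrite dual_associate_endpoint1 dual_associate_endpoint !pidem_associate -!scalemxAr.
rewrite !pidem_associate Eb Ec !scalerA -!scalerDl => e1 e2.
have vI a1 a2 : a1 *: (E t *m v) = a2 *: (E t *m v) -> a1 = a2.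
  move=> /eqP; rewrite -subr_eq0 -scalerBl scaler_eq0 subr_eq0.
  by rewrite (negPf pidem_dual_endpoint_neq0) orbF => /eqP.
have {}e1 : thetastar r1 * theta t = theta t * b + theta t1 * c.
  by apply/vI/e1 => i it; rewrite pidem_associate pidem_below_dual_endpoint ?scaler0.
have {}e2 : thetastar r = b + c by apply: vI.
rewrite FE Eb; congr (_ *: _); apply: (mulIf dt); rewrite divfK // e1 e2.
by ring.
Qed.
End EndpointVector.

(** Positive diameter gives a second index in the support of W, which forces r < D and t < D, so
    neither [inord] falls back to a default. The scalar is unique because E_t v is nonzero, and it
    acts on all of E_t W because E_t v spans that space. *)
Lemma a0star_formula (a : C) : (1 <= diameter Y x W)%N ->
  is_a0star E x W t a <->
  a = (thetastar (inord r.+1) * theta t - theta (inord t.+1) * thetastar r)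
        / (theta t - theta (inord t.+1)).
Proof.
rewrite /diameter ltn_predRL => /card_gt1P[k1 [k2 [/eqP k1W /eqP k2W k12]]].
have [k [kr kW]] : exists k, k != r /\ mx_image (Es k) W <> 0%VS.
  have [k1r|] := eqVneq k1 r; last by exists k1.
  by exists k2; rewrite -k1r eq_sym.
have rD : (r < D)%N.
  (* The endpoint is the least index of the support, so r < k <= D. *)
  have rk := hr.2 k kW; apply: leq_trans (_ : k <= D)%N; last by rewrite -ltnS.
  by rewrite ltn_neqAle rk andbT eq_sym (inj_eq val_inj).
have [v [lam [vW v0 vr vlam]]] := endpoint_eigenvector.
have tD := dual_endpoint_lt_diameter vW v0 vr rD vlam kr kW.
have F := Fstar_dual_endpoint vW v0 vr rD vlam tD.
have vt0 := pidem_dual_endpoint_neq0 vW v0 vr rD vlam.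
split=> [Fa|-> _ /mem_mx_image[w wW ->]].
  have vtW : E t *m v \in mx_image (E t) W by apply/mem_mx_image; exists v.
  have := Fa _ vtW; rewrite F => /eqP; rewrite -subr_eq0 -scalerBl scaler_eq0.
  by rewrite (negPf vt0) orbF subr_eq0 => /eqP <-.
have [c ->] := pidem_endpoint_span vW v0 vr rD vlam t wW.
by rewrite -scalemxAr F !scalerA mulrC.
Qed.

End Module.

(* The conclusion says that F^* acts on E_t W as a scalar and that this scalar
   is the stated quotient.  The indices r + 1 and t + 1 are at most D because
   1 <= diameter, so [inord] does return them. *)
Theorem theorem10p4 (R : realType) (X : finType) (D : nat) (hD : (3 <= D)%N)
  (Y : sym_scheme X D)
  (hP : P_polynomial Y)
  (hAB : almost_bipartite Y)
  (E : 'I_D.+1 -> 'M[R[i]]_#|X|)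
  (hE : primitive_idempotents Y E)
  (hQ : Q_polynomial E)
  (x : X)
  (theta thetastar : 'I_D.+1 -> R[i])
  (htheta : forall i : 'I_D.+1,
     associate_mx R[i] Y (inord 1) *m E i = theta i *: E i)
  (hthetastar : forall i : 'I_D.+1,
     dual_associate_mx E x *m dual_idempotent R[i] Y x i
       = thetastar i *: dual_idempotent R[i] Y x i)
  (W : {vspace 'cV[R[i]]_#|X|})
  (hW : irreducible_module (terwilliger_algebra Y x) W)
  (hd : (1 <= diameter Y x W)%N)
  (r t : 'I_D.+1)
  (hr : is_endpoint Y x W r)
  (ht : is_dual_endpoint E W t)
  (a : R[i]) :
  is_a0star E x W t a <->
  a = (thetastar (inord r.+1) * theta t - theta (inord t.+1) * thetastar r)
        / (theta t - theta (inord t.+1)).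
Proof. by apply: (a0star_formula (ltnW hD)). Qed.
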